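(* Let $X$ be a GNPC space and $p\in X$. Then any sufficiently small metric sphere around $p$ has the same homotopy type, independent of its radius, and is also homotopy equivalent to any sufficiently small punctured ball around $p$. That is, there is $r_0>0$ such that for all $0<r,s<r_0$ the metric spheres $\partial B(p,r)$ and $\partial B(p,s)$ are homotopy equivalent, and $\partial B(p,r)$ is homotopy equivalent to every punctured ball of radius $s$ around $p$.
   Context: A shortest path is an isometric embedding of a closed interval into a metric space; a geodesic space is a metric space in which any two points are joined by a shortest path. A complete geodesic space $(Y,d)$ is BNPC if for any two linearly (constant-speed) reparametrized shortest paths $\gamma,\eta:[0,1]\to Y$, the function $t\mapsto d(\gamma(t),\eta(t))$ is convex on $[0,1]$. A metric space is locally BNPC if every point has a neighborhood that is BNPC with respect to the ambient metric. A geodesic is a curve whose restriction to each sufficiently small subinterval is a shortest path. $X$ is locally geodesically complete if for every geodesic $\gamma:[a,b]\to X$ there exist $\varepsilon>0$ and a geodesic $\bar\gamma:[a-\varepsilon,b+\varepsilon]\to X$ with $\bar\gamma|_{[a,b]}=\gamma$. A GNPC space is a separable, locally compact, locally geodesically complete, locally BNPC metric space. The metric sphere is $\partial B(p,r)=\{x\in X: d(p,x)=r\}$; a punctured ball around $p$ is an open ball $B(p,s)$ or closed ball $\bar B(p,s)$ with $p$ removed. *)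

(* Defs.v *)
From HB Require Import structures.
From mathcomp Require Import all_boot all_order all_algebra.
From mathcomp Require Import all_classical all_reals all_analysis.

Set Implicit Arguments.
Unset Strict Implicit.
Unset Printing Implicit Defensive.

Import Order.TTheory GRing.Theory Num.Theory.
Import numFieldNormedType.Exports.

Local Open Scope classical_set_scope.
Local Open Scope ring_scope.

(* The library already makes [set_type A] a pseudometric space; this adds the
   restriction of the ambient distance, so that a subset can be treated as a
   metric space in its own right. *)
Section SubsetMetric.
Context {R : realType} {X : metricType R} (A : set X).

Let sub_dist (x y : set_type A) : R := mdist (set_val x) (set_val y).

Let sub_dist_ge0 x y : 0 <= sub_dist x y.
Proof. exact: mdist_ge0. Qed.

Let sub_dist_positivity x y : sub_dist x y = 0 -> x = y.
Proof. by move/mdist_positivity/val_inj. Qed.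

Let sub_ballE x d : ball x d = [set y | sub_dist x y < d].
Proof.
rewrite -[LHS](@initial_ballE R (set_type A) X set_val d x) ballEmdist.
by apply/seteqP; split.
Qed.

HB.instance Definition _ := PseudoMetric_isMetric.Build R (set_type A)
  sub_dist_ge0 sub_dist_positivity sub_ballE.

End SubsetMetric.

(* A map defined on a closed interval `[a, b] is represented by a total
   function on R of which only the values on `[a, b] are ever used. *)
Section Geodesics.
Context {R : realType} {X : metricType R}.

(* The degenerate interval a = b is allowed. *)
Definition shortest_path (a b : R) (g : R -> X) : Prop :=
  a <= b /\ {in `[a, b] &, forall s t, mdist (g s) (g t) = `|s - t|}.

Definition linear_shortest_path (g : R -> X) : Prop :=
  exists a b (h : R -> X), shortest_path a b h /\
    {in `[0, 1], forall t, g t = h (a + t * (b - a))}.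

Definition geodesic (a b : R) (g : R -> X) : Prop :=
  {within `[a, b], continuous g} /\
  exists2 d : R, 0 < d &
    forall c e, a <= c -> c <= e -> e <= b -> e - c < d -> shortest_path c e g.

End Geodesics.

Section Spaces.
Context {R : realType}.

Definition complete_metric (X : metricType R) : Prop :=
  forall F : set_system X, ProperFilter F -> cauchy F ->
  exists x : X, F --> x.

Definition geodesic_space (X : metricType R) : Prop :=
  forall x y : X, exists a b (g : R -> X),
    [/\ shortest_path a b g, g a = x & g b = y].

Definition BNPC (X : metricType R) : Prop :=
  [/\ complete_metric X, geodesic_space X &
    forall g h : R -> X, linear_shortest_path g -> linear_shortest_path h ->
      @convex_function R R^o `[0, 1]%classic (fun t => mdist (g t) (h t))].

Definition locally_BNPC (X : metricType R) : Prop :=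
  forall x : X, exists2 U : set X, nbhs x U & BNPC (set_type U).

Definition locally_geodesically_complete (X : metricType R) : Prop :=
  forall (a b : R) (g : R -> X), a < b -> geodesic a b g ->
  exists2 e : R, 0 < e &
  exists2 h : R -> X, geodesic (a - e) (b + e) h & {in `[a, b], h =1 g}.

Definition separable (X : topologicalType) : Prop :=
  exists2 D : set X, countable D & dense D.

Record GNPC (X : metricType R) : Prop := {
  GNPC_separable : separable X ;
  GNPC_locally_compact : locally_compact [set: X] ;
  GNPC_locally_geodesically_complete : locally_geodesically_complete X ;
  GNPC_locally_BNPC : locally_BNPC X }.

Definition metric_sphere (X : metricType R) (p : X) (r : R) : set X :=
  [set x | mdist p x = r].

(* Not the library's [closed_ball], which is the closure of the open ball and
   can be strictly smaller in a metric space. *)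
Definition metric_closed_ball (X : metricType R) (p : X) (r : R) : set X :=
  [set x | mdist p x <= r].

End Spaces.

Section Homotopy.
Variable R : realType.

(* The homotopy is a map S x [0, 1] -> T; as above, the unit interval is cut
   out of R by restricting the domain of continuity. *)
Definition homotopic (S T : topologicalType) (f g : S -> T) : Prop :=
  exists H : S * R -> T,
    [/\ {within [set: S] `*` `[0, 1], continuous H},
        forall x, H (x, 0) = f x &
        forall x, H (x, 1) = g x].

Definition homotopy_equivalent (S T : topologicalType) : Prop :=
  exists (f : S -> T) (g : T -> S),
    [/\ continuous f, continuous g,
        homotopic (g \o f) idfun & homotopic (f \o g) idfun].

End Homotopy.

(* Main.v *)
Require Import Defs.
From mathcomp Require Import all_boot all_order all_algebra.
From mathcomp Require Import all_classical all_reals all_analysis.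
From mathcomp Require Import ring lra.

(** Near [p] write |x| for the distance to [p]. Pulling points towards [p] along
    geodesics is continuous, by Busemann convexity; the difficulty is to push
    points away from [p] continuously, since a geodesic from [p] may be prolonged
    in many ways. The whole proof consists in constructing, on a punctured
    neighbourhood of [p], a continuous map [Q] with [Q (x, 0) = x] and
    |Q (x, a)| >= |x| + a / 2 ([outward_push]).

    Geodesics can be prolonged up to a fixed radius, by local geodesic
    completeness and compactness ([geo_extension], [extension_to_sphere]). Two
    geodesics from the same point spread at least linearly, so that the distance
    at parameter [l], divided by [l], has a limit as [l] tends to 0; as compactness
    makes the passage to the limit uniform, geodesics from [p] that branch at a
    small radius remain close, relatively to the radius, up to a fixed larger
    radius ([radial_almost_nonbranching]). Comparing again, now from the branch
    point, the prolongations of the geodesic from [p] to [x] by any length [a],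
    however small, lie within [2 / 5 * a] of each other
    ([small_scales_almost_nonbranching]). Hence the points within [a / 2] of all
    these prolongations form a nonempty convex set, which depends on [(x, a)] so
    that a continuous selection exists ([geodesic_selection]). A selected point
    moves by at most [3 / 2 * a] and gains at least [a / 2] in radius.

    Given [Q], any two sets defined by an interval of small radii are homotopy
    equivalent, if one is a sphere: push out, then pull back to the wanted radius.
    All the homotopies arise by letting the radii vary
    ([radial_set_homotopy_equivalent]). *)

Set Implicit Arguments.
Unset Strict Implicit.
Unset Printing Implicit Defensive.

Import Order.TTheory GRing.Theory Num.Theory.
Import numFieldNormedType.Exports.

Local Open Scope classical_set_scope.
Local Open Scope ring_scope.

(** * Metric preliminaries *)

Definition clamp01 {R : realType} (l : R) : R := Num.max 0 (Num.min 1 l).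

Lemma clamp01_itv {R : realType} (l : R) : 0 <= clamp01 l <= 1.
Proof.
by rewrite /clamp01 le_max lexx /= ge_max ler01 /= ge_min lexx.
Qed.

Lemma clamp01_id {R : realType} (l : R) : 0 <= l <= 1 -> clamp01 l = l.
Proof. by move=> /andP[l0 l1]; rewrite /clamp01 (min_r l1) (max_r l0). Qed.

Lemma clamp01_ge1 {R : realType} (l : R) : 1 <= l -> clamp01 l = 1.
Proof. by move=> l1; rewrite /clamp01 (min_l l1) max_r. Qed.

Lemma clamp01_le0 {R : realType} (l : R) : l <= 0 -> clamp01 l = 0.
Proof.
by move=> l0; rewrite /clamp01 min_r ?max_l// (le_trans l0).
Qed.

Lemma clamp01_lipschitz {R : realType} (l m : R) :
  `|clamp01 l - clamp01 m| <= `|l - m|.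
Proof.
have clampE (x : R) : clamp01 x = if x <= 0 then 0 else if 1 <= x then 1 else x.
  case: ifPn => [/clamp01_le0//|]; rewrite -ltNge => x0.
  case: ifPn => [/clamp01_ge1//|]; rewrite -ltNge => x1.
  by rewrite clamp01_id// !ltW.
rewrite !clampE.
case: (lerP l m) => lm.
- rewrite ler_norml.
  by do !case: ifPn; rewrite -?ltNge => *; apply/andP; split; lra.
- rewrite ler_norml.
  by do !case: ifPn; rewrite -?ltNge => *; apply/andP; split; lra.
Qed.

Lemma cvg_clamp01 {R : realType} {T : Type} (F : set_system T) {FF : Filter F}
    (f : T -> R) (l : R) :
  f t @[t --> F] --> l -> clamp01 (f t) @[t --> F] --> clamp01 l.
Proof.
move=> fl; apply/cvgrPdist_lt => e e0.
have /cvgrPdist_lt /(_ e e0) := fl.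
by apply: filterS => t; apply: le_lt_trans; exact: clamp01_lipschitz.
Qed.

Lemma le_mdistB {R : realType} {X : metricType R} (x y z : X) :
  `|mdist x z - mdist y z| <= mdist x y.
Proof.
have := metric_triangle x y z; have := metric_triangle y x z.
by rewrite (metric_sym y x) ler_norml => *; apply/andP; split; lra.
Qed.

Lemma cvg_mdist {R : realType} {X : metricType R} {T : Type}
    (F : set_system T) {FF : Filter F} (f g : T -> X) (x y : X) :
  f t @[t --> F] --> x -> g t @[t --> F] --> y ->
  mdist (f t) (g t) @[t --> F] --> mdist x y.
Proof.
move=> fx gy; apply/cvgrPdist_lt => e e0.
have e20 : 0 < e / 2 by rewrite divr_gt0.
near=> t.
have xf : mdist x (f t) < e / 2 by near: t; exact: metricType_numDomainType.cvgr_dist_lt fx _ e20.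
have yg : mdist y (g t) < e / 2 by near: t; exact: metricType_numDomainType.cvgr_dist_lt gy _ e20.
have := le_mdistB x (f t) y; have := le_mdistB y (g t) (f t).
rewrite (metric_sym y (f t)) (metric_sym (g t)).
rewrite !ler_norml ltr_norml => /andP[? ?] /andP[? ?].
by apply/andP; split; lra.
Unshelve. all: by end_near. Qed.

Lemma convex_function01 {R : realType} (f : R -> R) (l : R) :
  @convex_function R R^o `[0, 1]%classic f -> 0 <= l <= 1 ->
  f l <= (1 - l) * f 0 + l * f 1.
Proof.
move=> cf /andP[l0 l1].
have := cf (Itv01 l0 l1) 1 0; rewrite convRE /= /unstable.onem addrC.
have e : @conv R R^o (Itv01 l0 l1) 1 0 = l.
  by rewrite -[LHS]/(l * 1 + (1 - l) * 0); ring.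
by move=> h; rewrite -{1}e; apply: h; rewrite inE /= in_itv /= lexx ler01.
Qed.

(** The consequences of Busemann convexity of a subset, stated in the ambient
    space. The Lipschitz bound holds for all times, also outside the unit interval:
    each path is then continuous on the whole line, as the local prolongation of
    geodesics and the limits in the time parameter require. *)
Record geodesic_structure {R : realType} {X : metricType R} (U : set X)
    (geo : X -> X -> R -> X) : Prop := {
  geo_in : forall x y l, U x -> U y -> U (geo x y l) ;
  geo_lipschitz : forall x y l m, U x -> U y ->
    mdist (geo x y l) (geo x y m) <= `|l - m| * mdist x y ;
  geo_src : forall x y l, U x -> U y -> 0 <= l <= 1 ->
    mdist x (geo x y l) = l * mdist x y ;
  geo_tgt : forall x y l, U x -> U y -> 0 <= l <= 1 ->
    mdist (geo x y l) y = (1 - l) * mdist x y ;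
  geo_convex : forall x y x' y' l, U x -> U y -> U x' -> U y' -> 0 <= l <= 1 ->
    mdist (geo x y l) (geo x' y' l) <= (1 - l) * mdist x x' + l * mdist y y' ;
  geo_unique : forall x y z l, U x -> U y -> U z -> 0 <= l <= 1 ->
    mdist x z = l * mdist x y -> mdist z y = (1 - l) * mdist x y ->
    z = geo x y l }.

(** * Geodesics in a Busemann convex subset *)

Section BusemannGeodesics.
Context {R : realType} {Y : metricType R} (hY : BNPC Y).

Lemma linear_shortest_path_dist (g : R -> Y) : linear_shortest_path g ->
  {in `[0, 1] &, forall s t, mdist (g s) (g t) = `|s - t| * mdist (g 0) (g 1)}.
Proof.
move=> [a [b [h [[ab hh] gh]]]].
have inab (t : R) : t \in `[0, 1] -> a + t * (b - a) \in `[a, b].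
  rewrite !in_itv /= => /andP[t0 t1].
  have := mulr_ge0 t0 (_ : 0 <= b - a); rewrite subr_ge0 => /(_ ab) ?.
  have : 0 <= (1 - t) * (b - a) by rewrite mulr_ge0 ?subr_ge0.
  by move=> ?; apply/andP; split; lra.
have gE : {in `[0, 1] &, forall s t, mdist (g s) (g t) = `|s - t| * (b - a)}.
  move=> s t s01 t01; rewrite !gh// hh ?inab//.
  rewrite (_ : _ - _ = (s - t) * (b - a)); last by ring.
  by rewrite normrM (ger0_norm (_ : 0 <= b - a)) ?subr_ge0.
have i0 : 0 \in (`[0, 1] : interval R) by rewrite in_itv /= lexx ler01.
have i1 : 1 \in (`[0, 1] : interval R) by rewrite in_itv /= lexx ler01.
by move=> s t s01 t01; rewrite !gE// sub0r normrN1 mul1r.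
Qed.

Lemma linear_shortest_path_exists (x y : Y) :
  exists g : R -> Y, [/\ linear_shortest_path g, g 0 = x & g 1 = y].
Proof.
have [_ /(_ x y)[a [b [h [hh ha hb]]]] _] := hY.
exists (fun t => h (a + t * (b - a))); split.
- by exists a, b, h.
- by rewrite mul0r addr0.
- by rewrite mul1r addrC subrK.
Qed.

Lemma linear_shortest_path_convex (g h : R -> Y) (l : R) :
  linear_shortest_path g -> linear_shortest_path h -> 0 <= l <= 1 ->
  mdist (g l) (h l) <= (1 - l) * mdist (g 0) (h 0) + l * mdist (g 1) (h 1).
Proof.
have [_ _ conv] := hY => gl hl l01.
exact: (convex_function01 (conv _ _ gl hl)).
Qed.

(** The length of a concatenation is at most the sum of the lengths, and the
    additivity of the three distances forces equality on every subinterval. *)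
Lemma concat_shortest_path (g h : R -> Y) (a b : R) :
  0 < a -> 0 < b ->
  linear_shortest_path g -> linear_shortest_path h -> g 1 = h 0 ->
  mdist (g 0) (g 1) = a -> mdist (h 0) (h 1) = b ->
  mdist (g 0) (h 1) = a + b ->
  shortest_path 0 (a + b) (fun t => if t <= a then g (t / a) else h ((t - a) / b)).
Proof.
move=> a0 b0 gl hl gh ga hb tot; split; first by rewrite addr_ge0 ?ltW.
have anz : a != 0 by rewrite gt_eqF.
have bnz : b != 0 by rewrite gt_eqF.
have gi t : 0 <= t <= a -> t / a \in (`[0, 1] : interval R).
  by move=> /andP[? ?]; rewrite in_itv /= divr_ge0 ?ler_pdivrMr ?mul1r ?(ltW a0).
have hi t : a <= t <= a + b -> (t - a) / b \in (`[0, 1] : interval R).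
  move=> /andP[? ?]; rewrite in_itv /= divr_ge0 ?ler_pdivrMr ?mul1r ?(ltW b0) ?subr_ge0//=.
  by lra.
have gd s t : 0 <= s <= a -> 0 <= t <= a -> mdist (g (s / a)) (g (t / a)) = `|s - t|.
  move=> /gi ? /gi ?; rewrite linear_shortest_path_dist// ga -mulrBl normrM.
  by rewrite (gtr0_norm (_ : 0 < a^-1)) ?invr_gt0// divfK.
have hd s t : a <= s <= a + b -> a <= t <= a + b ->
    mdist (h ((s - a) / b)) (h ((t - a) / b)) = `|s - t|.
  move=> /hi ? /hi ?; rewrite linear_shortest_path_dist// hb -mulrBl normrM.
  rewrite (gtr0_norm (_ : 0 < b^-1)) ?invr_gt0// divfK//.
  by congr (`|_|); ring.
have key s t : 0 <= s <= a -> a <= t <= a + b ->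
    mdist (g (s / a)) (h ((t - a) / b)) = t - s.
  move=> sa ta; apply/eqP; rewrite eq_le; apply/andP; split.
    apply: (le_trans (metric_triangle _ (g 1) _)).
    have := gd s a sa; rewrite divff// lexx (ltW a0) => /(_ isT) ->.
    rewrite gh; have := hd a t _ ta; rewrite lexx subrr mul0r lerDl (ltW b0) => /(_ isT) ->.
    rewrite !ler0_norm; lra.
  have := metric_triangle (g 0) (g (s / a)) (h 1).
  have := metric_triangle (g (s / a)) (h ((t - a) / b)) (h 1).
  have := gd 0 s _ sa; rewrite mul0r lexx (ltW a0) => /(_ isT) ->.
  have := hd t (a + b) ta; rewrite (addrC a) addrK divff// (addrC b).
  rewrite lexx lerDl (ltW b0) => /(_ isT) ->.
  rewrite tot !ler0_norm; lra.
move=> s t; rewrite !in_itv /= => /andP[s0 s1] /andP[t0 t1].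
case: (lerP s a) => sa; case: (lerP t a) => ta.
- by rewrite gd ?s0 ?t0 ?sa ?ta.
- by rewrite key ?ler0_norm ?opprB; lra.
- by rewrite metric_sym key ?ger0_norm; lra.
- by rewrite hd//; lra.
Qed.

(** If [z] splits the distance in the ratio [l : 1 - l], then a shortest path
    through [z] is obtained by concatenation; its distance to [g] is convex and
    vanishes at both ends, so it vanishes at time [l]. *)
Lemma linear_shortest_path_unique (g : R -> Y) (z : Y) (l : R) :
  linear_shortest_path g -> 0 <= l <= 1 ->
  mdist (g 0) z = l * mdist (g 0) (g 1) ->
  mdist z (g 1) = (1 - l) * mdist (g 0) (g 1) ->
  z = g l.
Proof.
move=> gl l01 d0 d1.
have i0 : 0 \in (`[0, 1] : interval R) by rewrite in_itv /= lexx ler01.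
have i1 : 1 \in (`[0, 1] : interval R) by rewrite in_itv /= lexx ler01.
have il : l \in (`[0, 1] : interval R) by rewrite in_itv.
have [D0|Dn0] := eqVneq (mdist (g 0) (g 1)) 0.
  have z0 : g 0 = z by apply: mdist_positivity; rewrite d0 D0 mulr0.
  rewrite -z0; apply: mdist_positivity.
  by rewrite linear_shortest_path_dist// D0 mulr0.
have D0 : 0 < mdist (g 0) (g 1) by rewrite lt_neqAle eq_sym Dn0 mdist_ge0.
have [l0|ln0] := eqVneq l 0.
  by move: d0; rewrite l0 mul0r => /mdist_positivity.
have [l1|ln1] := eqVneq l 1.
  by move: d1; rewrite l1 subrr mul0r => /mdist_positivity.
case/andP: (l01) => l0 l1.
have {ln0 l0}l0 : 0 < l by rewrite lt_neqAle eq_sym ln0.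
have {ln1 l1}l1 : l < 1 by rewrite lt_neqAle ln1.
set D := mdist (g 0) (g 1) in d0 d1 D0 Dn0 *.
have [g1 [g1l g10 g11]] := linear_shortest_path_exists (g 0) z.
have [g2 [g2l g20 g21]] := linear_shortest_path_exists z (g 1).
have a0 : 0 < l * D by rewrite mulr_gt0.
have b0 : 0 < (1 - l) * D by rewrite mulr_gt0 ?subr_gt0.
have /= := @concat_shortest_path g1 g2 _ _ a0 b0 g1l g2l.
rewrite g10 g11 g20 g21 => /(_ erefl d0 d1).
rewrite -/D (_ : l * D + (1 - l) * D = D); last by ring.
move=> /(_ erefl).
set k := fun t => _ => ksp.
pose k' t := k (0 + t * (D - 0)).
have k'l : linear_shortest_path k' by exists 0, D, k.
have := @linear_shortest_path_convex g k' l gl k'l l01.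
rewrite /k' /k !add0r !subr0 mul0r (ltW a0) mul0r mul1r g10 mdistxx mulr0 add0r.
rewrite lexx divff ?gt_eqF// g11.
rewrite ifF; last by apply/negbTE; rewrite -ltNge -[X in _ < X]mul1r ltr_pM2r.
rewrite (_ : (D - l * D) / ((1 - l) * D) = 1); last first.
  rewrite (_ : D - l * D = (1 - l) * D) ?divff//; last by ring.
  by rewrite gt_eqF.
rewrite g21 mdistxx mulr0 => /(conj (mdist_ge0 (g l) z)) /andP/le_anti/esym.
by move/mdist_positivity.
Qed.

End BusemannGeodesics.

Section BusemannSubset.
Context {R : realType} {X : metricType R} (U : set X) (hU : BNPC (set_type U)).

Lemma BNPC_geodesic_structure :
  exists geo : X -> X -> R -> X, geodesic_structure U geo.
Proof.
have H (xy : X * X) : exists g : R -> X, U xy.1 -> U xy.2 ->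
    exists g' : R -> set_type U, [/\ linear_shortest_path g',
      forall t, g t = set_val (g' t), set_val (g' 0) = xy.1 & set_val (g' 1) = xy.2].
  case: xy => x y /=.
  have [Ux|nUx] := pselect (U x); last by exists (fun=> x).
  have [Uy|nUy] := pselect (U y); last by exists (fun=> x).
  pose x' : set_type U := SigSub (mem_set Ux).
  pose y' : set_type U := SigSub (mem_set Uy).
  have [g [gl g0 g1]] := linear_shortest_path_exists hU x' y'.
  exists (fun t => set_val (g t)) => _ _; exists g; split => //.
    by rewrite g0.
  by rewrite g1.
have [c cP] := choice H; clear H.
exists (fun x y l => c (x, y) (clamp01 l)).
have P x y : U x -> U y -> exists g' : R -> set_type U,
    [/\ linear_shortest_path g',
      forall t, c (x, y) t = set_val (g' t), set_val (g' 0) = x & set_val (g' 1) = y].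
  by move=> Ux Uy; exact: (cP (x, y)).
have i0 : 0 \in (`[0, 1] : interval R) by rewrite in_itv /= lexx ler01.
have i1 : 1 \in (`[0, 1] : interval R) by rewrite in_itv /= lexx ler01.
have ic (l : R) : clamp01 l \in (`[0, 1] : interval R) by rewrite in_itv /= clamp01_itv.
split.
- move=> x y l Ux Uy; have [g [_ -> _ _]] := P x y Ux Uy; exact: set_valP.
- move=> x y l m Ux Uy; have [g [gl cg g0 g1]] := P x y Ux Uy.
  rewrite !cg -[X in X <= _]/(mdist (g (clamp01 l)) (g (clamp01 m))).
  rewrite linear_shortest_path_dist// -[mdist (g 0) _]/(mdist (set_val (g 0)) (set_val (g 1))).
  by rewrite g0 g1 ler_wpM2r ?mdist_ge0// clamp01_lipschitz.
- move=> x y l Ux Uy l01; have [g [gl cg g0 g1]] := P x y Ux Uy.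
  rewrite cg -{1 2}g0 -g1 -[LHS]/(mdist (g 0) (g (clamp01 l))).
  rewrite linear_shortest_path_dist// clamp01_id// sub0r normrN ger0_norm//.
  by case/andP: l01.
- move=> x y l Ux Uy l01; have [g [gl cg g0 g1]] := P x y Ux Uy.
  rewrite cg -{1}g0 -g1 -[LHS]/(mdist (g (clamp01 l)) (g 1)).
  rewrite linear_shortest_path_dist// clamp01_id// distrC ger0_norm//.
  by rewrite subr_ge0; case/andP: l01.
- move=> x y x' y' l Ux Uy Ux' Uy' l01.
  have [g [gl cg g0 g1]] := P x y Ux Uy.
  have [h [hl ch h0 h1]] := P x' y' Ux' Uy'.
  rewrite cg ch clamp01_id// -g0 -g1 -h0 -h1.
  exact: (linear_shortest_path_convex hU gl hl l01).
- move=> x y z l Ux Uy Uz l01; have [g [gl cg g0 g1]] := P x y Ux Uy.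
  rewrite cg -g0 -g1 clamp01_id// => d0 d1.
  pose z' : set_type U := SigSub (mem_set Uz).
  by rewrite -(@linear_shortest_path_unique _ _ hU g z' l).
Qed.

End BusemannSubset.

Definition between {R : realType} {X : metricType R} (x y z : X) : Prop :=
  mdist x z = mdist x y + mdist y z.

Lemma between_trans {R : realType} {X : metricType R} (x y z w : X) :
  between x y z -> between x z w -> between x y w.
Proof.
rewrite /between => xyz xzw.
have := metric_triangle x y w; have := metric_triangle y z w.
by move=> *; apply/eqP; rewrite eq_le; apply/andP; split; lra.
Qed.

(** * Calculus of geodesics *)

Section GeodesicStructureTheory.
Context {R : realType} {X : metricType R} (U : set X) (geo : X -> X -> R -> X).
Context (hg : geodesic_structure U geo).

Lemma geo0 x y : U x -> U y -> geo x y 0 = x.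
Proof.
move=> Ux Uy; apply/esym/mdist_positivity.
by rewrite (geo_src hg)// ?lexx ?ler01// mul0r.
Qed.

Lemma geo1 x y : U x -> U y -> geo x y 1 = y.
Proof.
move=> Ux Uy; apply: mdist_positivity.
by rewrite (geo_tgt hg)// ?lexx ?ler01// subrr mul0r.
Qed.

Lemma geo_refl x l : U x -> geo x x l = x.
Proof.
move=> Ux; rewrite -[RHS](geo0 Ux Ux); apply: mdist_positivity.
apply/eqP; rewrite eq_le mdist_ge0 andbT.
by rewrite (le_trans (geo_lipschitz hg _ _ Ux Ux))// mdistxx mulr0.
Qed.

Lemma mdist_geo_le (z x y : X) l : U z -> U x -> U y -> 0 <= l <= 1 ->
  mdist z (geo x y l) <= (1 - l) * mdist z x + l * mdist z y.
Proof. by move=> Uz Ux Uy l01; rewrite -{1}(geo_refl l Uz) (geo_convex hg). Qed.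

Lemma cvg_geo {T : Type} (F : set_system T) {FF : Filter F}
    (f g : T -> X) (l : T -> R) (x y : X) (m : R) :
  U x -> U y -> (\forall t \near F, U (f t)) -> (\forall t \near F, U (g t)) ->
  (forall t, 0 <= l t <= 1) ->
  f t @[t --> F] --> x -> g t @[t --> F] --> y -> l t @[t --> F] --> m ->
  geo (f t) (g t) (l t) @[t --> F] --> geo x y m.
Proof.
move=> Ux Uy Uf Ug l01 fx gy lm.
apply/metricType_numDomainType.cvgrPdist_lt => e e0.
have e40 : 0 < e / 4 by rewrite divr_gt0.
have D0 : 0 < mdist x y + 1 by rewrite ltr_wpDl ?mdist_ge0.
near=> t.
have xf : mdist x (f t) < e / 4.
  by near: t; exact: metricType_numDomainType.cvgr_dist_lt fx _ e40.
have yg : mdist y (g t) < e / 4.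
  by near: t; exact: metricType_numDomainType.cvgr_dist_lt gy _ e40.
have ml : `|m - l t| < e / 4 / (mdist x y + 1).
  by near: t; apply: (@cvgr_dist_lt _ R^o) => //; rewrite divr_gt0.
have Uft : U (f t) by near: t.
have Ugt : U (g t) by near: t.
have h1 := geo_lipschitz hg m (l t) Ux Uy.
have h2 := geo_convex hg Ux Uy Uft Ugt (l01 t).
have h3 := metric_triangle (geo x y m) (geo x y (l t)) (geo (f t) (g t) (l t)).
have h4 : `|m - l t| * mdist x y <= e / 4.
  rewrite -[leRHS](divfK (lt0r_neq0 D0)); apply: ler_pM => //.
  - exact: mdist_ge0.
  - exact: ltW.
  - by rewrite lerDl.
have /andP[l0 l1] := l01 t.
have h5 : (1 - l t) * mdist x (f t) <= mdist x (f t).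
  by rewrite ler_piMl ?mdist_ge0//; lra.
have h6 : l t * mdist y (g t) <= mdist y (g t) by rewrite ler_piMl ?mdist_ge0.
by lra.
Unshelve. all: by end_near. Qed.

Lemma geo_dist x y l m : U x -> U y -> 0 <= l <= 1 -> 0 <= m <= 1 ->
  mdist (geo x y l) (geo x y m) = `|l - m| * mdist x y.
Proof.
move=> Ux Uy l01 m01; apply/eqP; rewrite eq_le (geo_lipschitz hg)//=.
have := le_mdistB (geo x y l) (geo x y m) x.
rewrite !(metric_sym _ x) !(geo_src hg)// -mulrBl normrM.
by rewrite (ger0_norm (mdist_ge0 _ _)).
Qed.

Lemma geo_comp x y l m : U x -> U y -> 0 <= l <= 1 -> 0 <= m <= 1 ->
  geo x (geo x y l) m = geo x y (m * l).
Proof.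
move=> Ux Uy l01 m01; have Uz : U (geo x y l) by exact: (geo_in hg).
case/andP: (l01) => l0 l1; case/andP: (m01) => m0 m1.
have ml0 : 0 <= m * l by rewrite mulr_ge0.
have ml1 : m * l <= 1 by rewrite mulr_ile1.
have d1 : mdist x (geo x (geo x y l) m) = m * l * mdist x y.
  by rewrite !(geo_src hg)// mulrA.
have d2 := metric_triangle (geo x (geo x y l) m) (geo x y l) y.
rewrite !(geo_tgt hg)// (geo_src hg)// in d2.
have d3 := metric_triangle x (geo x (geo x y l) m) y.
apply: (geo_unique hg) => //; rewrite ?ml0 //.
  exact: (geo_in hg).
by apply/eqP; rewrite eq_le; apply/andP; split; rewrite ?d1 in d3 *; lra.
Qed.

(** Busemann's comparison: two geodesics from the same point spread at least
    linearly. *)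
Lemma geo_contract x y z l m : U x -> U y -> U z -> 0 <= m <= l -> 0 < l <= 1 ->
  mdist (geo x y m) (geo x z m) <= m / l * mdist (geo x y l) (geo x z l).
Proof.
move=> Ux Uy Uz /andP[m0 ml] /andP[l0 l1].
have lnz : l != 0 by rewrite gt_eqF.
have l01 : 0 <= l <= 1 by rewrite ltW.
have q01 : 0 <= m / l <= 1.
  by rewrite divr_ge0 ?(ltW l0)//= ler_pdivrMr// mul1r.
rewrite -{1 2}(divfK lnz m) -(geo_comp Ux Uy l01 q01) -(geo_comp Ux Uz l01 q01).
have := geo_convex hg Ux (geo_in hg l Ux Uy) Ux (geo_in hg l Ux Uz) q01.
by rewrite mdistxx mulr0 add0r.
Qed.

Lemma between_geo x y z : U x -> U y -> U z -> x != z -> between x y z ->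
  y = geo x z (mdist x y / mdist x z).
Proof.
move=> Ux Uy Uz; rewrite -(mdist_gt0 x z) => D0 xyz.
have Dnz : mdist x z != 0 by rewrite gt_eqF.
apply: (geo_unique hg) => //.
- rewrite divr_ge0 ?mdist_ge0// ler_pdivrMr// mul1r xyz lerDl mdist_ge0//.
- by rewrite divfK.
- by rewrite mulrBl mul1r divfK// xyz; ring.
Qed.

(** Local completeness continues the path from [x] to [y] to a local geodesic,
    hence to a shortest path near [y]. It is shortest all the way from [x]: the
    distance to [x] is convex along it and grows at unit speed before [y], so it
    cannot grow slower after [y]. *)
Lemma geo_extension (x y : X) (e : R) :
  locally_geodesically_complete X ->
  U x -> nbhs y U -> x != y -> 0 < e ->
  exists z : X, [/\ between x y z, 0 < mdist y z & mdist y z < e].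
Proof.
move=> lgc Ux nyU; rewrite -(mdist_gt0 x y) => D0 e0.
have Uy : U y by exact: nbhs_singleton.
set D := mdist x y in D0 *.
have Dnz : D != 0 by rewrite gt_eqF.
pose g (s : R) := geo x y (s / D).
have gs s : 0 <= s <= D -> 0 <= s / D <= 1.
  by move=> /andP[s0 s1]; rewrite divr_ge0 ?(ltW D0)//= ler_pdivrMr// mul1r.
have gg : geodesic 0 D g.
  split.
    apply: continuous_subspaceT => s.
    apply/metricType_numDomainType.cvgrPdist_lt => r r0.
    have /cvgrPdist_lt /(_ r r0) := (@cvg_id _ (nbhs s)).
    apply: filterS => t; apply: le_lt_trans.
    apply: (le_trans (geo_lipschitz hg _ _ Ux Uy)).
    rewrite -mulrBl normrM (gtr0_norm (_ : 0 < D^-1)) ?invr_gt0// -/D divfK//.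
  exists 1 => // c f c0 cf fD _; split => // s t; rewrite !in_itv /= => /andP[? ?] /andP[? ?].
  rewrite /g geo_dist// ?gs ?(le_trans c0)//=; try exact: le_trans fD.
  rewrite -mulrBl normrM (gtr0_norm (_ : 0 < D^-1)) ?invr_gt0// -/D divfK//.
have [e1 e10 [h [_ [d d0 hd] hgE]]] := lgc 0 D g D0 gg.
move/metricType_numDomainType.nbhs_mdistP : nyU => [e2 /= e20 e2U].
(* The path [h] will be used on [D - m, D + m]: this has to fit in the interval
   where [h] lives, be shorter than the scale [d] at which [h] is shortest, and
   end in [U] at distance less than [e] from [y]. *)
pose m := Num.min (Num.min e1 (d / 3)) (Num.min D (Num.min e e2)) / 2.
have [m0 [me1 [md [mD [me me2]]]]] : 0 < m /\ m < e1 /\ m * 2 < d /\ m < D /\ m < e /\ m < e2.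
  have : 0 < m * 2 by rewrite /m divfK// !lt_min e10 divr_gt0// D0 e0.
  have : m * 2 <= e1 by rewrite /m divfK// !ge_min lexx.
  have : m * 2 <= d / 3 by rewrite /m divfK// !ge_min lexx ?orbT.
  have : m * 2 <= D by rewrite /m divfK// !ge_min lexx ?orbT.
  have : m * 2 <= e by rewrite /m divfK// !ge_min lexx ?orbT.
  have : m * 2 <= e2 by rewrite /m divfK// !ge_min lexx ?orbT.
  by move=> *; repeat split; lra.
have [_ hsp] := hd (D - m) (D + m) ltac:(lra) ltac:(lra) ltac:(lra) ltac:(lra).
have hD : h D = y by rewrite hgE ?in_itv /= ?lexx ?(ltW D0)// /g divff// geo1.
have hDm : h (D - m) = geo x y ((D - m) / D) by rewrite hgE ?in_itv /=; [|lra].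
set w := h (D - m) in hDm; set z := h (D + m).
have ic t : D - m <= t <= D + m -> t \in (`[D - m, D + m] : interval R) by rewrite in_itv.
have wy : mdist w y = m.
  by rewrite -hD hsp ?ic ?ler0_norm; lra.
have yz : mdist y z = m.
  by rewrite -hD hsp ?ic ?ler0_norm; lra.
have wz : mdist w z = m + m.
  by rewrite hsp ?ic ?ler0_norm; lra.
have Uz : U z by apply: e2U => /=; rewrite yz.
have Uw : U w by rewrite hDm; exact: (geo_in hg).
have xw : mdist x w = D - m.
  by rewrite hDm (geo_src hg)// ?gs -/D ?divfK//; lra.
(* Midpoint convexity of the distance to [x] along the path from [w] to [z]. *)
have half : 0 <= (2^-1 : R) <= 1 by lra.
have yE : y = geo w z 2^-1.
  by apply: (geo_unique hg) => //; rewrite ?wy ?yz wz; lra.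
exists z; rewrite /between yz; split => //.
have := mdist_geo_le Ux Uw Uz half; rewrite -yE xw -/D.
have := metric_triangle x y z; rewrite yz -/D.
by move=> *; apply/eqP; rewrite eq_le; apply/andP; split; lra.
Qed.

End GeodesicStructureTheory.

(** * Prolonging the geodesics from the centre *)

Record normal_ball {R : realType} {X : metricType R} (U : set X)
    (geo : X -> X -> R -> X) (p : X) (r : R) : Prop := {
  nb_geo : geodesic_structure U geo ;
  nb_gt0 : 0 < r ;
  nb_sub : forall z, mdist p z <= r -> U z ;
  nb_compact : compact (metric_closed_ball p r) ;
  nb_extension : forall x, 0 < mdist p x -> mdist p x < r ->
    exists y, [/\ between p x y, 0 < mdist x y & mdist p y <= r] }.

Lemma closed_metric_closed_ball {R : realType} {X : metricType R} (p : X) (r : R) :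
  closed (metric_closed_ball p r).
Proof.
rewrite (_ : metric_closed_ball p r = (fun x => mdist p x) @^-1` [set t | t <= r])//.
apply: preimage_closed; last exact: closed_le.
by move=> x _; apply: cvg_mdist; [exact: cvg_cst|exact: cvg_id].
Qed.

Lemma GNPC_normal_ball {R : realType} {X : metricType R} (p : X) : GNPC X ->
  exists U geo r, @normal_ball R X U geo p r.
Proof.
move=> [_ lc lgc lB].
have [U nU /BNPC_geodesic_structure [geo hg]] := lB p.
have [K wK [cK _]] := lc p I.
have nK : nbhs p K by have : \near p, [set: X] p -> K p := wK; apply: filterS => z; apply.
have /metricType_numDomainType.nbhs_mdistP [e /= e0 eKU] : nbhs p (K `&` U).
  exact: filterI.
have ball_nbhs z : mdist p z < e -> nbhs z U.
  move=> pz; apply/metricType_numDomainType.nbhs_mdistP.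
  exists (e - mdist p z) => /=; first by rewrite subr_gt0.
  move=> w /= zw; suff /eKU[] : mdist p w < e by [].
  by have := metric_triangle p z w; lra.
have pe : mdist p p < e by rewrite mdistxx.
exists U, geo, (e / 2); split => //.
- by rewrite divr_gt0.
- by move=> z pz; suff /eKU[] : mdist p z < e by []; lra.
- apply: (@subclosed_compact _ _ K) => //; first exact: closed_metric_closed_ball.
  by move=> z /= pz; suff /eKU[] : mdist p z < e by []; rewrite /metric_closed_ball/= in pz; lra.
- move=> x x0 xe.
  have xU : nbhs x U by apply: ball_nbhs; lra.
  have px : p != x by rewrite -(mdist_gt0 p x).
  have Up : U p by apply: nbhs_singleton; exact: ball_nbhs.
  have ex0 : 0 < e / 2 - mdist p x by rewrite subr_gt0.
  have [y [pxy xy0 xye]] := geo_extension hg lgc Up xU px ex0.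
  by exists y; split => //; rewrite pxy; lra.
Qed.

Section NormalBall.
Context {R : realType} {X : metricType R} (U : set X) (geo : X -> X -> R -> X).
Context (p : X) (r : R).
Context (hb : normal_ball U geo p r).
Let hg := nb_geo hb.
Let r0 : 0 < r := nb_gt0 hb.
Let Up : U p. Proof. by apply: (nb_sub hb); rewrite mdistxx ltW. Qed.

(** Among the prolongations inside the compact ball, one that ends farthest from
    the centre must end on the sphere. *)
Lemma extension_to_sphere (x : X) : 0 < mdist p x -> mdist p x <= r ->
  exists2 y, between p x y & mdist p y = r.
Proof.
move=> x0 xr.
pose A := metric_closed_ball p r `&` [set y | between p x y].
have dc z : continuous (mdist (z : X)).
  by move=> y; apply: cvg_mdist; [exact: cvg_cst|exact: cvg_id].
have cA : compact A.
  apply: compact_closedI; first exact: nb_compact hb.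
  rewrite (_ : mkset _ = (fun y => mdist p y - mdist x y) @^-1` [set mdist p x]).
    apply: preimage_closed; last exact: closed_eq.
    by move=> y _; apply: cvgB; exact: dc.
  by apply/seteqP; split => y; rewrite /between /= => h; lra.
have A0 : A !=set0.
  by exists x; split => //=; rewrite /between mdistxx addr0.
have [y] := compact_EVT_max A0 cA (continuous_subspaceT (dc p)).
rewrite inE => -[/= yr pxy] ymax.
exists y => //; apply/eqP; rewrite eq_le yr /= leNgt; apply/negP => yltr.
have y0 : 0 < mdist p y by rewrite pxy ltr_wpDr ?mdist_ge0.
have [z [pyz yz0 zr]] := nb_extension hb y0 yltr.
have := ymax z; rewrite inE => /(_ (conj zr (between_trans pxy pyz))).
by rewrite pyz leNgt ltrDl yz0.
Qed.

(** The rescaled distance between two radial geodesics at parameter [l],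
    divided by [l], is nondecreasing in [l]. For each pair it is therefore either
    below [r / 5] at some parameter [m], and then stays so for nearby pairs and
    all smaller parameters, or at least [r / 5] at all parameters, in which case
    nearby pairs never meet. Compactness of the set of pairs makes the scale
    uniform. *)
Lemma radial_almost_nonbranching : exists l0 : R, [/\ 0 < l0, l0 <= 1 &
  forall u v l, mdist p u = r -> mdist p v = r -> 0 < l -> l <= l0 ->
    geo p u l = geo p v l ->
    mdist (geo p u l0) (geo p v l0) <= l0 * r / 5].
Proof.
have K2 := compact_setX (nb_compact hb) (nb_compact hb).
pose P (l0 : R) (uv : X * X) := U uv.1 -> U uv.2 -> forall l, 0 < l -> l <= l0 ->
    geo p uv.1 l = geo p uv.2 l ->
    mdist (geo p uv.1 l0) (geo p uv.2 l0) <= l0 * r / 5.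
have kr : 0 < r / 15 by rewrite divr_gt0.
have H : \forall l0 \near (0 : R)^'+,
    metric_closed_ball p r `*` metric_closed_ball p r `<=` P l0.
  apply: (compact_near_coveringP _).1 K2 _ _ _ _ _ => -[u v] [/= ur vr].
  have Uu := nb_sub hb ur; have Uv := nb_sub hb vr.
  have near_ball (z : X) (e : R) : 0 < e -> \forall z' \near z, mdist z z' < e.
    by move=> e0; apply/metricType_numDomainType.nbhs_mdistP; exists e.
  have [[m m01 muv]|far] := pselect (exists2 m : R, 0 < m <= 1 &
      mdist (geo p u m) (geo p v m) < m * r / 5).
    case/andP: (m01) => m0 m1.
    set D := mdist _ _ in muv; pose e := (m * r / 5 - D) / 2.
    have e0 : 0 < e by rewrite divr_gt0// subr_gt0.
    near=> uv i => /= Uu' Uv' l l0 li _.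
    have i0 : 0 < i by near: i; exact: nbhs_right_gt.
    have im : i <= m by near: i; exact: nbhs_right_le.
    have uu' : mdist u uv.1 < e.
      by near: uv; exact: (@cvg_fst _ _ (nbhs u) (nbhs v) _ _ (near_ball u _ e0)).
    have vv' : mdist v uv.2 < e.
      by near: uv; exact: (@cvg_snd _ _ (nbhs u) (nbhs v) _ _ (near_ball v _ e0)).
    have i0m : 0 <= i <= m by rewrite ltW.
    have m01' : 0 <= m <= 1 by rewrite ltW.
    apply: (le_trans (geo_contract hg Up Uu' Uv' i0m m01)).
    have h2 := geo_convex hg Up Uu Up Uu' m01'.
    have h3 := geo_convex hg Up Uv Up Uv' m01'.
    rewrite mdistxx mulr0 add0r in h2; rewrite mdistxx mulr0 add0r in h3.
    have h4 : m * mdist u uv.1 <= mdist u uv.1 by rewrite ler_piMl ?mdist_ge0.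
    have h5 : m * mdist v uv.2 <= mdist v uv.2 by rewrite ler_piMl ?mdist_ge0.
    have h6 := metric_triangle (geo p uv.1 m) (geo p u m) (geo p uv.2 m).
    have h7 := metric_triangle (geo p u m) (geo p v m) (geo p uv.2 m).
    rewrite (metric_sym _ (geo p u m)) -/D in h6 h7.
    have -> : i * r / 5 = i / m * (m * r / 5) by field; rewrite gt_eqF.
    apply: ler_wpM2l; first by rewrite divr_ge0 ?ltW.
    by rewrite /e in uu' vv'; lra.
  near=> uv i => /= Uu' Uv' l l0 li luv.
  exfalso; apply: far; exists l.
    rewrite l0 (le_trans li)//; near: i; exact: nbhs_right_le.
  have uu' : mdist u uv.1 < r / 15.
    by near: uv; exact: (@cvg_fst _ _ (nbhs u) (nbhs v) _ _ (near_ball u _ kr)).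
  have vv' : mdist v uv.2 < r / 15.
    by near: uv; exact: (@cvg_snd _ _ (nbhs u) (nbhs v) _ _ (near_ball v _ kr)).
  have l01 : 0 <= l <= 1.
    rewrite ltW// (le_trans li)//; near: i; exact: nbhs_right_le.
  have h2 := geo_convex hg Up Uu Up Uu' l01.
  have h3 := geo_convex hg Up Uv Up Uv' l01.
  rewrite mdistxx mulr0 add0r in h2; rewrite mdistxx mulr0 add0r in h3.
  have h4 := metric_triangle (geo p u l) (geo p uv.1 l) (geo p v l).
  rewrite {2}luv (metric_sym (geo p uv.2 l)) in h4.
  have h5 : l * mdist u uv.1 < l * (r / 15) by rewrite ltr_pM2l.
  have h6 : l * mdist v uv.2 < l * (r / 15) by rewrite ltr_pM2l.
  by have := mulr_gt0 l0 kr; lra.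
have [l0 [l00 l01 Pl0]] : exists l0, [/\ 0 < l0, l0 <= 1 &
    metric_closed_ball p r `*` metric_closed_ball p r `<=` P l0].
  near (0 : R)^'+ => l0; exists l0; split; near: l0.
  - exact: nbhs_right_gt.
  - exact: nbhs_right_le.
  - exact: H.
exists l0; split => // u v l ur vr lpos ll0 uv.
have Uu : U u by apply: (nb_sub hb); rewrite ur.
have Uv : U v by apply: (nb_sub hb); rewrite vr.
apply: (Pl0 (u, v) _ Uu Uv l lpos ll0 uv).
by rewrite /metric_closed_ball; split => /=; rewrite ?ur ?vr.
Unshelve. all: by end_near. Qed.

End NormalBall.

(** * The prolongations of a radial geodesic stay close *)

Definition almost_nonbranching {R : realType} {X : metricType R} (p : X) (r1 : R) : Prop :=
  forall x y z a, 0 < mdist p x -> mdist p x <= r1 / 2 -> a <= r1 / 2 ->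
    between p x y -> mdist x y = a -> between p x z -> mdist x z = a ->
    mdist y z <= 2 / 5 * a.

Section Extensions.
Context {R : realType} {X : metricType R} (U : set X) (geo : X -> X -> R -> X).
Context (p : X) (r : R).
Context (hb : normal_ball U geo p r).
Let hg := nb_geo hb.
Let r0 : 0 < r := nb_gt0 hb.
Let Up : U p. Proof. by apply: (nb_sub hb); rewrite mdistxx ltW. Qed.

Lemma extension_at_distance (x : X) (a : R) :
  0 < mdist p x -> 0 <= a -> mdist p x + a <= r ->
  exists2 y, between p x y & mdist x y = a.
Proof.
move=> x0 a0 xar.
have [|u pxu ur] := extension_to_sphere hb x0; first by lra.
have Uu : U u by apply: (nb_sub hb); rewrite ur.
have Ux : U x by apply: (nb_sub hb); lra.
have pu : p != u by rewrite -(mdist_gt0 p u) ur.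
have q01 : 0 <= (mdist p x + a) / r <= 1.
  by rewrite divr_ge0 ?(ltW r0)//= ?ler_pdivrMr ?mul1r// addr_ge0// mdist_ge0.
have x01 : 0 <= mdist p x / r <= 1.
  by rewrite divr_ge0 ?(ltW r0)//= ?ler_pdivrMr ?mul1r// ?mdist_ge0//; lra.
have xE := between_geo hg Up Ux Uu pu pxu; rewrite ur in xE.
have dx : mdist x (geo p u ((mdist p x + a) / r)) = a.
  rewrite {1}xE (geo_dist hg)// ur -mulrBl normrM (gtr0_norm (_ : 0 < r^-1)) ?invr_gt0//.
  by rewrite divfK ?gt_eqF// ler0_norm; lra.
exists (geo p u ((mdist p x + a) / r)) => //.
by rewrite /between dx (geo_src hg)// ur divfK ?gt_eqF.
Qed.

(** Prolong [y] and [z] to the outer sphere. The resulting radial geodesics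
    pass through [x], hence at radius [l0 * r] they are [l0 * r / 5] apart; seen
    from [x] this distance shrinks linearly down to scale [a]. The factor 2 comes
    from [x] lying in the inner half of that radius. *)
Lemma small_scales_almost_nonbranching : exists r1 : R,
  [/\ 0 < r1, r1 <= r & almost_nonbranching p r1].
Proof.
have [l0 [l00 l01 nb]] := radial_almost_nonbranching hb.
have r10 : 0 < l0 * r by rewrite mulr_gt0.
have r1r : l0 * r <= r by rewrite ler_piMl ?(ltW r0).
exists (l0 * r); split => // x y z a x0 xr1 ar1 pxy xya pxz xza.
have a0 : 0 <= a by rewrite -xya mdist_ge0.
have Ux : U x by apply: (nb_sub hb); lra.
(* A prolongation [w] of [x] lies on the geodesic from [x] to the point at
   radius [l0 * r] of some radial geodesic through [x]. *)
have ladder w : between p x w -> mdist x w = a -> exists u, [/\ mdist p u = r,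
    geo p u (mdist p x / r) = x &
    w = geo x (geo p u l0) (a / (l0 * r - mdist p x))].
  move=> pxw xw.
  have w0 : 0 < mdist p w by rewrite pxw xw; lra.
  have wr : mdist p w <= r by rewrite pxw xw; lra.
  have [u pwu ur] := extension_to_sphere hb w0 wr.
  have pxu := between_trans pxw pwu.
  have Uu : U u by apply: (nb_sub hb); rewrite ur.
  have Uw : U w by apply: (nb_sub hb).
  have pu : p != u by rewrite -(mdist_gt0 p u) ur.
  have xE := between_geo hg Up Ux Uu pu pxu.
  have wE := between_geo hg Up Uw Uu pu pwu.
  rewrite ur in xE wE.
  exists u; split => //.
  have in01 t : 0 <= t <= r -> 0 <= t / r <= 1.
    by move=> /andP[? ?]; rewrite divr_ge0 ?(ltW r0)//= ler_pdivrMr ?mul1r.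
  have dl0 v t : v = geo p u (t / r) -> 0 <= t <= l0 * r ->
      mdist v (geo p u l0) = l0 * r - t.
    move=> -> /andP[t0 t1]; rewrite (geo_dist hg) ?in01 ?(ltW l00)//; last first.
      by rewrite t0 (le_trans t1).
    rewrite ur -{2}(gtr0_norm r0) -normrM mulrBl divfK ?gt_eqF// ler0_norm; lra.
  have d1 := dl0 _ _ xE; have d2 := dl0 _ _ wE.
  rewrite pxw xw in d2.
  apply: (geo_unique hg) => //.
  - exact: (geo_in hg).
  - by rewrite divr_ge0 ?ler_pdivrMr/= ?mul1r//; lra.
  - by rewrite d1 ?divfK ?xw// ?gt_eqF//; lra.
  - by rewrite d1 ?d2 ?mulrBl ?mul1r ?divfK ?gt_eqF//; lra.
have [u [ur ux yE]] := ladder y pxy xya.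
have [v [vr vx zE]] := ladder z pxz xza.
have Uu : U u by apply: (nb_sub hb); rewrite ur.
have Uv : U v by apply: (nb_sub hb); rewrite vr.
have xr0 : 0 < mdist p x / r by rewrite divr_gt0.
have xl0 : mdist p x / r <= l0 by rewrite ler_pdivrMr//; lra.
have close := nb u v (mdist p x / r) ur vr xr0 xl0 (etrans ux (esym vx)).
have q01 : 0 <= a / (l0 * r - mdist p x) <= 1.
  by rewrite divr_ge0 ?ler_pdivrMr/= ?mul1r//; lra.
rewrite yE zE.
apply: (le_trans (geo_convex hg Ux (geo_in hg _ Up Uu) Ux (geo_in hg _ Up Uv) q01)).
rewrite mdistxx mulr0 add0r.
have s0 : 0 < l0 * r - mdist p x by lra.
apply: (le_trans (ler_wpM2l _ close)); first by case/andP: q01.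
rewrite mulrAC ler_pdivrMr//.
rewrite (_ : 2 / 5 * a * _ = a * (2 / 5 * (l0 * r - mdist p x))); last by ring.
by rewrite ler_wpM2l//; lra.
Qed.

(** Half the length is the threshold that matters: if [w.1] has a prolongation of
    length [w.2], such an [e] is farther from the centre than [w.1] by [w.2 / 2].
    Closeness to all prolongations makes the set of these [e] geodesically convex. *)
Definition extension_at_most_half_away (w : X * R) (e : X) : Prop :=
  U e /\ forall y, mdist p y <= r -> between p w.1 y -> mdist w.1 y = w.2 ->
    mdist y e < w.2 / 2.

(** Prolongations vary upper semicontinuously, because limits of prolongations
    are prolongations and the ball is compact; the margin between 2 / 5 and 1 / 2
    absorbs the variation. *)
Lemma extension_at_most_half_away_near (r1 : R) (x : X) (a : R) :
  r1 <= r ->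
  almost_nonbranching p r1 ->
  0 < mdist p x -> mdist p x < r1 / 2 -> 0 < a -> a < r1 / 2 ->
  exists2 e, U e & \forall w \near (x, a), extension_at_most_half_away w e.
Proof.
move=> r1r close x0 xr1 a0 ar1.
have [|e pxe xe] := extension_at_distance x0 (ltW a0); first by lra.
have Ue : U e by apply: (nb_sub hb); rewrite pxe xe; lra.
exists e => //.
pose P (w : X * R) (y : X) := between p w.1 y -> mdist w.1 y = w.2 -> mdist y e < w.2 / 2.
suff H : \forall w \near (x, a), metric_closed_ball p r `<=` P w.
  by apply: filterS H => w Pw; split => // y yr; exact: Pw.
apply: ((compact_near_coveringP _).1 (nb_compact hb) _ (nbhs (x, a)) P _) => y yr.
have c1 : yw.1 @[yw --> (y, (x, a))] --> y by exact: cvg_fst.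
have c2 : yw.2.1 @[yw --> (y, (x, a))] --> x.
  by apply: (cvg_comp _ _ cvg_snd); exact: cvg_fst.
have c3 : yw.2.2 @[yw --> (y, (x, a))] --> a.
  by apply: (cvg_comp _ _ cvg_snd); exact: cvg_snd.
have cc (z : X) : (fun=> z) yw @[yw --> (y, (x, a))] --> z by exact: cvg_cst.
have [[pxy xya]|nxy] := pselect (between p x y /\ mdist x y = a).
  have cf : yw.2.2 / 2 - mdist yw.1 e @[yw --> (y, (x, a))] --> a / 2 - mdist y e.
    by apply: cvgB; [apply: cvgM => //; exact: cvg_cst|exact: cvg_mdist].
  have f0 : 0 < a / 2 - mdist y e.
    by have := close x y e a x0 (ltW xr1) (ltW ar1) pxy xya pxe xe; lra.
  apply: (filterS _ (cvgr_gt _ cf _ f0)).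
  by move=> -[y' w] /= h _ _; rewrite -subr_gt0.
pose f (yw : X * (X * R)) := `|mdist p yw.1 - (mdist p yw.2.1 + mdist yw.2.1 yw.1)|
  + `|mdist yw.2.1 yw.1 - yw.2.2|.
have cf : f yw @[yw --> (y, (x, a))] --> f (y, (x, a)).
  apply: cvgD; apply: cvg_norm; apply: cvgB => //.
  - exact: cvg_mdist.
  - by apply: cvgD; exact: cvg_mdist.
  - exact: cvg_mdist.
have f0 : 0 < f (y, (x, a)).
  rewrite lt_neqAle addr_ge0// andbT eq_sym; apply/eqP => /eqP.
  rewrite paddr_eq0// !normr_eq0 !subr_eq0 => /andP[/eqP h1 /eqP h2].
  exact: nxy.
apply: (filterS _ (cvgr_gt _ cf _ f0)).
move=> -[y' w] /=; rewrite /f /= => h b d; exfalso; move: h.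
by rewrite b d !subrr normr0 addr0 ltxx.
Qed.

End Extensions.

(** * Continuous selections *)

(** A selection theorem for geodesically convex values, with locally constant
    local selections. These are merged by moving successively towards
    the points [e k], for [k] decreasing to 0, along the fraction [phi k w] of the
    geodesic. Where some [phi k] equals 1, the point [e k] is reached at stage [k]
    and everything done before is forgotten: the result does not depend on the
    number of stages, and no local finiteness is required. *)
Lemma geodesic_selection {R : realType} {X : metricType R} (U : set X)
    (geo : X -> X -> R -> X) (T : topologicalType) (W : set T)
    (G : T -> set X) (phi : nat -> T -> R) (p : X) :
  geodesic_structure U geo -> U p ->
  (forall w, G w `<=` U) ->
  (forall w x y l, G w x -> G w y -> 0 <= l <= 1 -> G w (geo x y l)) ->
  (forall k, continuous (phi k)) ->
  (forall k w, 0 <= phi k w <= 1) ->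
  (forall w N, W w -> nbhs w N -> exists2 k,
    (\forall w' \near w, phi k w' = 1) & forall w', 0 < phi k w' -> N w') ->
  (forall w, W w -> exists2 e, U e & \forall w' \near w, W w' -> G w' e) ->
  exists q : T -> X, (forall w, U (q w)) /\
    forall w, W w -> G w (q w) /\ {for w, continuous q}.
Proof.
move=> hg Up GU Gconv phic phi01 bump lower.
pose good k e := forall w', 0 < phi k w' -> W w' -> G w' e.
have /choice[e eP] : forall k, exists e,
    U e /\ ((exists2 x, U x & good k x) -> good k e).
  move=> k.
  have [[x Ux gx]|bad] := pselect (exists2 x, U x & good k x); first by exists x.
  by exists p; split => // /bad.
have Ue k : U (e k) := (eP k).1.
pose psi k w := if `[< good k (e k) >] then phi k w else 0.
have psi01 k w : 0 <= psi k w <= 1.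
  by rewrite /psi; case: ifPn => // _; rewrite lexx ler01.
have psic k : continuous (psi k).
  rewrite /psi; case: asboolP => _; first exact: phic.
  by move=> w; exact: cvg_cst.
have psi_good k w : psi k w = 0 \/ (W w -> G w (e k)).
  rewrite /psi; case: asboolP => [gk|]; last by left.
  have /andP[] := phi01 k w; rewrite le_eqVlt => /orP[/eqP <-|pw _]; first by left.
  by right => Ww; exact: gk.
have psi_cover w : W w -> exists k, \forall w' \near w, psi k w' = 1.
  move=> Ww; have [x Ux nx] := lower w Ww.
  have [k k1 kN] := bump w _ Ww nx.
  exists k; apply: filterS k1 => w' w'1; rewrite /psi ifT//; apply/asboolP.
  by apply: (eP k).2; exists x.
pose step w k z := geo z (e k) (psi k w).
pose Q s w := foldr (step w) p s.
have QU s w : U (Q s w) by elim: s => //= k s IH; exact: (geo_in hg).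
have Qc s : continuous (Q s).
  elim: s => [|k s IH] w; first exact: cvg_cst.
  have nU (f : T -> X) : (forall w', U (f w')) -> \forall w' \near w, U (f w').
    by move=> Uf; exact: nearW.
  apply: (cvg_geo hg (QU s w) (Ue k) (nU _ (QU s)) (nU _ (fun=> Ue k)) (psi01 k)).
  - exact: IH.
  - exact: cvg_cst.
  - exact: psic.
have Q_stable k n w : psi k w = 1 -> Q (iota 0 (k.+1 + n)) w = Q (iota 0 k.+1) w.
  move=> k1; rewrite /Q -addn1 -addnA !iotaD !foldr_cat add0n; congr foldr.
  by rewrite /= /step k1 !(geo1 hg)//; exact: QU.
have QG k w : W w -> psi k w = 1 -> G w (Q (iota 0 k.+1) w).
  move=> Ww k1; rewrite /Q -addn1 iotaD foldr_cat add0n.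
  set z := foldr _ _ (iota k 1).
  have : G w z.
    rewrite /z /= /step k1 (geo1 hg)//.
    by case: (psi_good k w) => [/eqP|]; [rewrite k1 oner_eq0|apply].
  elim: (iota 0 k) => //= j s IH Gz.
  have Gs := IH Gz; rewrite {1}/step.
  have [->|/(_ Ww) Ge] := psi_good j w; last exact: Gconv.
  by rewrite (geo0 hg)//; exact: GU Gs.
have Q_indep j k w : psi j w = 1 -> psi k w = 1 ->
    Q (iota 0 j.+1) w = Q (iota 0 k.+1) w.
  wlog jk : j k / (j <= k)%N.
    by move=> H j1 k1; have [|/ltnW] := leqP j k => /H; [|move=> /(_ k1 j1)]; auto.
  by move=> j1 _; rewrite -(subnKC jk) -addSn Q_stable.
have /choice[N NP] : forall w, exists k, (exists j, psi j w = 1) -> psi k w = 1.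
  move=> w; have [[k k1]|no] := pselect (exists j, psi j w = 1); first by exists k.
  by exists 0%N.
exists (fun w => Q (iota 0 (N w).+1) w); split => // w Ww.
have [k kw] := psi_cover w Ww.
have k1 := nbhs_singleton kw.
split; first by apply: QG => //; apply: NP; exists k.
rewrite /prop_for /continuous_at (Q_indep _ k)//; last by apply: NP; exists k.
apply: cvg_trans (Qc (iota 0 k.+1) w).
apply: near_eq_cvg; apply: filterS kw => w' w'1.
by apply: Q_indep => //; apply: NP; exists k.
Qed.

(** * Pushing points away from the centre *)

Lemma separable_dense_sequence {R : realType} {X : metricType R} (p : X) :
  separable X ->
  exists c : nat -> X, forall (x : X) (e : R), 0 < e -> exists n, mdist x (c n) < e.
Proof.
move=> [D /countable_injP[f finj] dD].
have /choice[c cP] : forall n, exists x, forall d, D d -> f d = n -> x = d.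
  move=> n; have [[d Dd fd]|no] := pselect (exists2 d, D d & f d = n).
    by exists d => d' Dd' fd'; apply: finj; rewrite ?inE// fd fd'.
  by exists p => d Dd fd; exfalso; apply: no; exists d.
exists c => x e e0.
have xO : (ball x e)^° x by exact: nbhsx_ballx.
have [d [xd Dd]] := dD _ (ex_intro _ x xO) (@open_interior _ (ball x e)).
exists (f d); rewrite (cP _ d)//.
by have := interior_subset xd; rewrite ballEmdist.
Qed.

(** Plateau functions centred at the points of a countable dense set, of radius
    [1 / m.+1] for the plateau and [2 / m.+1] for the support. *)
Lemma bump_sequence {R : realType} {X : metricType R} (p : X) :
  separable X -> exists phi : nat -> X * R -> R,
    [/\ forall k, continuous (phi k), forall k w, 0 <= phi k w <= 1 &
    forall (w : X * R) (N : set (X * R)), nbhs w N -> exists2 k,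
      (\forall w' \near w, phi k w' = 1) & forall w', 0 < phi k w' -> N w'].
Proof.
move=> /(separable_dense_sequence p)[c cD].
pose s (n : nat) (q : rat) (w : X * R) : R := mdist (c n) w.1 + `|ratr q - w.2|.
pose phi k (w : X * R) : R := if unpickle k is Some (n, q, m) then
  clamp01 (2 - m.+1%:R * s n q w) else 0.
have s_cont n q : continuous (s n q).
  move=> w; apply: cvgD.
    by apply: cvg_mdist; [exact: cvg_cst|exact: cvg_fst].
  by apply: cvg_norm; apply: cvgB; [exact: cvg_cst|exact: cvg_snd].
exists phi; split.
- move=> k; rewrite /phi; case: unpickle => [[[n q] m]|] w; last exact: cvg_cst.
  apply: cvg_clamp01; apply: cvgB; first exact: cvg_cst.
  by apply: cvgM; [exact: cvg_cst|exact: s_cont].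
- move=> k w; rewrite /phi; case: unpickle => [[[n q] m]|].
    exact: clamp01_itv.
  by rewrite lexx ler01.
- move=> [x a] N [[A B] /= [nA nB] ABN].
  move/metricType_numDomainType.nbhs_mdistP : nA => [eA /= eA0 eA_sub].
  move/(@metricType_numDomainType.nbhs_mdistP R R^o) : nB => [eB /= eB0 eB_sub].
  pose e := Num.min eA eB.
  have e0 : 0 < e by rewrite lt_min eA0.
  pose m := Num.bound (3 / e).
  have M0 : 0 < m.+1%:R :> R by [].
  have Me : 3 < m.+1%:R * e.
    rewrite -ltr_pdivrMr//.
    apply: (lt_trans (archi_boundP _)); first by rewrite divr_ge0 ?ltW.
    by rewrite ltr_nat.
  (* Radius [2 / m.+1] plus the distance to the new centre stays below [e]. *)
  have [d d0 Md] : exists2 d : R, 0 < d & m.+1%:R * d = 4^-1.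
    exists (4 * m.+1%:R)^-1; first by rewrite invr_gt0 mulr_gt0.
    by rewrite invfM mulrCA divff ?mulr1// gt_eqF.
  have [n xn] := cD x _ d0.
  have ad : a - d < a + d by lra.
  have [q] := rat_in_itvoo ad.
  rewrite in_itv /= => /andP[q1 q2].
  have qa : `|ratr q - a| < d.
    by rewrite ltr_norml; apply/andP; split; lra.
  have Mx : m.+1%:R * mdist x (c n) < 4^-1 by rewrite -Md ltr_pM2l.
  have Mq : m.+1%:R * `|ratr q - a| < 4^-1 by rewrite -Md ltr_pM2l.
  exists (pickle (n, q, m)).
    have : 0 < 1 - m.+1%:R * s n q (x, a).
      by rewrite /s /= mulrDr (metric_sym (c n)); lra.
    have cf : 1 - m.+1%:R * s n q w' @[w' --> (x, a)] --> 1 - m.+1%:R * s n q (x, a).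
      by apply: cvgB; [exact: cvg_cst|apply: cvgM; [exact: cvg_cst|exact: s_cont]].
    move=> /(cvgr_gt _ cf); apply: filterS => w' h.
    by rewrite /phi pickleK clamp01_ge1//; lra.
  move=> [x' a']; rewrite /phi pickleK => h.
  have {h}h : m.+1%:R * s n q (x', a') < 2.
    by rewrite ltNge; apply/negP => h'; move: h; rewrite clamp01_le0 ?ltxx//; lra.
  rewrite /s /= mulrDr in h.
  have t1 := metric_triangle x (c n) x'.
  have t2 : `|a' - a| <= `|ratr q - a| + `|ratr q - a'|.
    by rewrite (distrC _ a') (_ : a' - a = (ratr q - a) + (a' - ratr q)) ?ler_normD//; ring.
  have n1 : 0 <= m.+1%:R * mdist (c n) x' by rewrite mulr_ge0 ?mdist_ge0.
  have n2 : 0 <= m.+1%:R * `|ratr q - a'| by rewrite mulr_ge0.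
  have u1 : m.+1%:R * mdist x x' < m.+1%:R * e.
    by have := ler_wpM2l (ltW M0) t1; rewrite mulrDr; lra.
  have u2 : m.+1%:R * `|a' - a| < m.+1%:R * e.
    by have := ler_wpM2l (ltW M0) t2; rewrite mulrDr; lra.
  rewrite !ltr_pM2l// !lt_min in u1 u2.
  apply: ABN; split => /=.
    by apply: eA_sub => /=; case/andP: u1.
  by apply: eB_sub => /=; rewrite /mdist /=; case/andP: u2.
Qed.

(** For [a > 0] the point [Q (x, a)] is selected within [a / 2] of all
    prolongations of the geodesic from [p] to [x] by the length [a]. So the
    distance to [p] grows by at least [a / 2], and the displacement is at most
    [3 / 2 * a], which gives continuity at [a = 0]. *)
Lemma outward_push {R : realType} {X : metricType R} (U : set X)
    (geo : X -> X -> R -> X) (p : X) (r : R) :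
  separable X -> normal_ball U geo p r ->
  exists (r2 : R) (Q : X * R -> X), [/\ 0 < r2, 4 * r2 <= r &
    forall x a, 0 < mdist p x -> mdist p x < r2 -> a < 2 * r2 ->
    [/\ {for (x, a), continuous Q}, U (Q (x, a)), a <= 0 -> Q (x, a) = x &
        0 <= a -> mdist p x + a / 2 <= mdist p (Q (x, a))]].
Proof.
move=> sepX hb; have hg := nb_geo hb.
have r0 := nb_gt0 hb.
have [r1 [r10 r1r close]] := small_scales_almost_nonbranching hb.
have [phi [phic phi01 bump]] := bump_sequence p sepX.
pose W := [set w : X * R | [/\ 0 < mdist p w.1, mdist p w.1 < r1 / 2,
  0 < w.2 & w.2 < r1 / 2]].
have Up : U p by apply: (nb_sub hb); rewrite mdistxx ltW.
have [q [qU qW]] : exists q : X * R -> X, (forall w, U (q w)) /\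
    forall w, W w -> extension_at_most_half_away U p r w (q w) /\ {for w, continuous q}.
  apply: (geodesic_selection (G := extension_at_most_half_away U p r) hg Up _ _ phic phi01).
  - by move=> w e [].
  - move=> w x y l [Ux hx] [Uy hy] l01; split; first exact: (geo_in hg).
    move=> z zr pz wz.
    have := mdist_geo_le hg (nb_sub hb zr) Ux Uy l01.
    have := hx z zr pz wz; have := hy z zr pz wz.
    case/andP: l01 => l0 l1.
    case: (eqVneq l 0) => [->|ln0]; first by lra.
    have lp : 0 < l by rewrite lt_neqAle eq_sym ln0.
    move=> hy' hx'; have := ler_wpM2l (_ : 0 <= 1 - l) (ltW hx'); rewrite subr_ge0 => /(_ l1).
    by have := hy'; rewrite -(ltr_pM2l lp); lra.
  - by move=> w N _; exact: bump.
  - move=> [x a] [/= x0 xr a0 ar].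
    have [e Ue ne] := extension_at_most_half_away_near hb r1r close x0 xr a0 ar.
    by exists e => //; apply: filterS ne.
have qP x a : W (x, a) -> exists y, [/\ between p x y, mdist x y = a & mdist y (q (x, a)) < a / 2].
  move=> Wxa; have [/= x0 xr a0 ar] := Wxa; have [[_ qy] _] := qW _ Wxa.
  have [|y pxy xya] := extension_at_distance hb x0 (ltW a0); first by lra.
  by exists y; split => //; apply: qy => //=; rewrite pxy xya; lra.
pose Q (w : X * R) := if w.2 <= 0 then w.1 else q w.
exists (r1 / 4), Q; split; [by rewrite divr_gt0|by rewrite mulrC divfK|].
have Qdist x a : 0 < mdist p x -> mdist p x < r1 / 4 -> a < 2 * (r1 / 4) ->
    mdist x (Q (x, a)) <= 2 * Num.max 0 a.
  move=> x0 xr ar; rewrite /Q /=; case: (lerP a 0) => a0.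
    by rewrite mdistxx mulr0.
  have [|y [_ xy yq]] := qP x a; first by split => //=; lra.
  by have := metric_triangle x y (q (x, a)); lra.
move=> x a x0 xr ar; split.
- case: (ltP 0 a) => a0.
    have Wxa : W (x, a) by split => //=; lra.
    have [_ cq] := qW _ Wxa.
    rewrite /prop_for /continuous_at {2}/Q /= leNgt a0 /=.
    apply: cvg_trans cq; apply: near_eq_cvg.
    apply: (filterS _ (cvgr_gt _ (cvg_snd : w.2 @[w --> (x, a)] --> a) _ a0)).
    by move=> w w0; rewrite /Q leNgt w0.
  apply/metricType_numDomainType.cvgrPdist_lt => e e0.
  have c1 : w.1 @[w --> (x, a)] --> x by exact: cvg_fst.
  have c2 : w.2 @[w --> (x, a)] --> a by exact: cvg_snd.
  have c3 : mdist p w.1 @[w --> (x, a)] --> mdist p x by apply: cvg_mdist; [exact: cvg_cst|].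
  have c4 : mdist x w.1 @[w --> (x, a)] --> mdist x x by apply: cvg_mdist; [exact: cvg_cst|].
  have e80 : 0 < e / 8 by rewrite divr_gt0.
  near=> w.
  rewrite {1}/Q /= a0.
  have w10 : 0 < mdist p w.1 by near: w; exact: cvgr_gt c3 _ x0.
  have w1r : mdist p w.1 < r1 / 4 by near: w; exact: cvgr_lt c3 _ xr.
  have w2r : w.2 < 2 * (r1 / 4) by near: w; exact: cvgr_lt c2 _ ar.
  have w2e : w.2 < e / 8 by near: w; apply: cvgr_lt c2 _ _; lra.
  have w1x : mdist x w.1 < e / 2.
    by near: w; apply: cvgr_lt c4 _ _; rewrite mdistxx divr_gt0.
  have := Qdist w.1 w.2 w10 w1r w2r; rewrite -surjective_pairing => h.
  have := metric_triangle x w.1 (Q w).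
  have : Num.max 0 w.2 < e / 8 by rewrite gt_max e80.
  by lra.
- rewrite /Q /=; case: ifP => _; last exact: qU.
  by apply: (nb_sub hb); lra.
- by rewrite /Q /= => ->.
- rewrite le_eqVlt => /orP[/eqP <-|a0].
    by rewrite /Q /= lexx mul0r addr0.
  rewrite /Q /= (leNgt a) a0 /=.
  have [|y [pxy xy yq]] := qP x a; first by split => //=; lra.
  by have := metric_triangle p (q (x, a)) y; rewrite pxy xy (metric_sym _ y); lra.
Unshelve. all: by end_near. Qed.

(** * Homotopy equivalences between radial sets *)

Lemma homotopy_equivalent_sym (R : realType) (S T : topologicalType) :
  homotopy_equivalent R S T -> homotopy_equivalent R T S.
Proof. by move=> [f [g [cf cg gf fg]]]; exists g, f; split. Qed.

Section MapsIntoSubsets.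
Context {R : realType} {X : metricType R} (A : set X) (S : topologicalType).

Definition corestrict (h : S -> X) (hA : forall x, A (h x)) (x : S) : set_type A :=
  SigSub (mem_set (hA x)).

Lemma continuous_corestrict (h : S -> X) (hA : forall x, A (h x)) :
  continuous h -> continuous (corestrict hA).
Proof. by move=> ch; apply: continuous_comp_initial. Qed.

(** Clamping the time makes the homotopy total, so it is enough that it takes
    values in [A] during the unit interval. *)
Lemma homotopic_into_subset (f g : S -> set_type A) (k : S -> R -> X) :
  (forall x t, 0 <= t <= 1 -> A (k x t)) ->
  continuous (fun z : S * R => k z.1 (clamp01 z.2)) ->
  (forall x, k x 0 = set_val (f x)) -> (forall x, k x 1 = set_val (g x)) ->
  homotopic R f g.
Proof.
move=> kA ck kf kg.
have kA' (z : S * R) : A (k z.1 (clamp01 z.2)) by apply: kA; exact: clamp01_itv.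
exists (fun z => SigSub (mem_set (kA' z))); split.
- by apply: continuous_subspaceT; apply: continuous_comp_initial.
- by move=> x; apply: val_inj; rewrite /= clamp01_le0 ?kf.
- by move=> x; apply: val_inj; rewrite /= clamp01_ge1 ?kg.
Qed.

End MapsIntoSubsets.

Section RadialSets.
Context {R : realType} {X : metricType R} (U : set X) (geo : X -> X -> R -> X).
Context (p : X) (r r2 : R) (Q : X * R -> X).
Context (hb : normal_ball U geo p r) (r2r : 4 * r2 <= r).
Context (hQ : forall x a, 0 < mdist p x -> mdist p x < r2 -> a < 2 * r2 ->
    [/\ {for (x, a), continuous Q}, U (Q (x, a)), a <= 0 -> Q (x, a) = x &
        0 <= a -> mdist p x + a / 2 <= mdist p (Q (x, a))]).
Let hg := nb_geo hb.
Let Up : U p. Proof. by apply: (nb_sub hb); rewrite mdistxx ltW// (nb_gt0 hb). Qed.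

Definition radial_retract (z : X) (m : R) : X := geo p z (clamp01 (m / mdist p z)).

Definition push (y : X) (a m : R) : X := radial_retract (Q (y, a)) m.

Lemma radial_retract_radius z m : U z -> 0 < mdist p z -> 0 <= m <= mdist p z ->
  mdist p (radial_retract z m) = m.
Proof.
move=> Uz z0 /andP[m0 mz]; rewrite /radial_retract (geo_src hg) ?clamp01_itv//.
by rewrite clamp01_id ?divfK ?gt_eqF// divr_ge0 ?(ltW z0)//= ler_pdivrMr// mul1r.
Qed.

Lemma radial_retract_id z : U z -> 0 < mdist p z -> radial_retract z (mdist p z) = z.
Proof.
by move=> Uz z0; rewrite /radial_retract divff ?gt_eqF// clamp01_ge1// (geo1 hg).
Qed.

Lemma radial_retract_twice z m n : U z -> 0 <= n -> n <= m -> 0 < m -> m <= mdist p z ->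
  radial_retract (radial_retract z m) n = radial_retract z n.
Proof.
move=> Uz n0 nm m0 mz.
have z0 : 0 < mdist p z by exact: lt_le_trans mz.
have E : radial_retract z m = geo p z (m / mdist p z).
  by rewrite /radial_retract clamp01_id// divr_ge0 ?(ltW z0) ?(ltW m0)//= ler_pdivrMr// mul1r.
rewrite {1}/radial_retract radial_retract_radius ?(ltW m0)// E.
rewrite (geo_comp hg) ?clamp01_itv//; last first.
  by rewrite divr_ge0 ?(ltW z0) ?(ltW m0)//= ler_pdivrMr// mul1r.
rewrite /radial_retract !clamp01_id.
- by congr geo; field; rewrite !gt_eqF.
- by rewrite divr_ge0 ?(ltW z0)//= ler_pdivrMr// mul1r (le_trans nm).
- by rewrite divr_ge0 ?(ltW m0)//= ler_pdivrMr// mul1r.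
Qed.

Lemma cvg_radial_retract {T : Type} (F : set_system T) {FF : Filter F}
    (f : T -> X) (m : T -> R) (z : X) (n : R) :
  (forall t, U (f t)) -> U z -> 0 < mdist p z ->
  f t @[t --> F] --> z -> m t @[t --> F] --> n ->
  radial_retract (f t) (m t) @[t --> F] --> radial_retract z n.
Proof.
move=> Uf Uz z0 fz mn.
have Upp : \forall t \near F, U p by exact: nearW.
have Uff : \forall t \near F, U (f t) by exact: nearW.
apply: (cvg_geo hg Up Uz Upp Uff) => //; first by move=> t; exact: clamp01_itv.
  exact: cvg_cst.
apply: cvg_clamp01; apply: cvgM => //; apply: cvgV; first by rewrite gt_eqF.
by apply: cvg_mdist => //; exact: cvg_cst.
Qed.

Lemma cvg_push {T : Type} (F : set_system T) {FF : Filter F}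
    (f : T -> X) (a m : T -> R) (y : X) (b n : R) :
  (forall t, 0 < mdist p (f t) < r2) -> (forall t, a t < 2 * r2) ->
  0 < mdist p y < r2 -> 0 <= b < 2 * r2 ->
  f t @[t --> F] --> y -> a t @[t --> F] --> b -> m t @[t --> F] --> n ->
  push (f t) (a t) (m t) @[t --> F] --> push y b n.
Proof.
move=> fr ar /andP[y0 yr] /andP[b0 br] fy ab mn.
have [cQ UQ _ Qr] := hQ y0 yr br.
apply: cvg_radial_retract => //.
- by move=> t; have /andP[f0 fr2] := fr t; have [] := hQ f0 fr2 (ar t).
- by have := Qr b0; lra.
- by apply: (cvg_comp _ _ (cvg_pair fy ab)).
Qed.

Lemma push_radius y a m : 0 < mdist p y < r2 -> 0 <= a < 2 * r2 ->
  0 <= m <= mdist p y + a / 2 -> mdist p (push y a m) = m.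
Proof.
move=> /andP[y0 yr] /andP[a0 ar] /andP[m0 my].
have [_ UQ _ Qr] := hQ y0 yr ar.
by have := Qr a0; move=> ?; apply: radial_retract_radius => //; [|apply/andP; split]; lra.
Qed.

Lemma push0 y m : 0 < mdist p y < r2 -> push y 0 m = radial_retract y m.
Proof.
move=> /andP[y0 yr]; have r20 : 0 < 2 * r2 by lra.
by have [_ _ Q0 _] := hQ y0 yr r20; rewrite /push Q0.
Qed.

(** Both maps change the radius: from [x] one is pushed out by at least
    [rho - mdist p x] and pulled back to radius exactly [rho], and the inverse
    pulls back to radius [s]. Letting the amount of pushing and the target radius
    vary together connects the two composites to the identity without leaving the
    prescribed set of radii. *)
Lemma radial_set_homotopy_equivalent (I : set R) (rho s : R) :
  (forall a b c, I a -> I b -> a <= c <= b -> I c) ->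
  (forall a, I a -> 0 < a < r2) ->
  I s -> s <= rho -> rho < r2 ->
  homotopy_equivalent R (set_type [set x | I (mdist p x)])
                        (set_type (metric_sphere p rho)).
Proof.
move=> Iconv Ir Is srho rhor.
set T := mkset _; set S := metric_sphere p rho.
have s0 : 0 < s by case/andP: (Ir _ Is).
have rho0 : 0 < rho by exact: lt_le_trans srho.
have Tr (x : T) : 0 < mdist p (set_val x) < r2 by exact: (Ir _ (set_valP x)).
have Sr (x : S) : mdist p (set_val x) = rho by exact: (set_valP x).
have r2r4 := r2r.
have US (x : S) : U (set_val x) by apply: (nb_sub hb); rewrite Sr; lra.
have UT (x : T) : U (set_val x) by apply: (nb_sub hb); have := Tr x; lra.
have cvgT : continuous (set_val : T -> X) by exact: initial_continuous.
have cvgS : continuous (set_val : S -> X) by exact: initial_continuous.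
pose gap (x : X) := Num.max 0 (rho - mdist p x).
have gap0 x : 0 <= gap x by rewrite le_max lexx.
have gapr x : 0 < mdist p x -> gap x < r2 by rewrite gt_max; lra.
have gap_rho x : rho <= mdist p x + gap x by rewrite -lerBlDl le_max lexx orbT.
have cgap (A : Type) (F : set_system A) (FF : Filter F) (h : A -> X) (x : X) :
    h t @[t --> F] --> x -> gap (h t) @[t --> F] --> gap x.
  move=> hx; apply/cvgrPdist_lt => e e0.
  have c : mdist p (h t) @[t --> F] --> mdist p x by apply: cvg_mdist => //; exact: cvg_cst.
  have /cvgrPdist_lt /(_ e e0) := c; apply: filterS => t; apply: le_lt_trans.
  by rewrite /gap; case: (lerP 0 (rho - mdist p x)); case: (lerP 0 (rho - mdist p (h t)));
    case: (lerP (mdist p x) (mdist p (h t))) => *; rewrite ler_norml; apply/andP; split; lra.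
have fS (x : T) : S (push (set_val x) (2 * gap (set_val x)) rho).
  have /andP[x0 xr] := Tr x.
  rewrite /S /metric_sphere /= push_radius ?Tr//.
    by have := gapr _ x0; have := gap0 (set_val x); lra.
  by have := gap_rho (set_val x); lra.
have gT (x : S) : T (radial_retract (set_val x) s).
  by rewrite /T /= radial_retract_radius ?US ?Sr// (ltW s0).
exists (corestrict fS), (corestrict gT); split.
- apply: continuous_corestrict => x; apply: (cvg_push (FF := nbhs_filter x)) => //.
  + by move=> t; have /andP[/gapr] := Tr t; lra.
  + by have /andP[/gapr] := Tr x; have := gap0 (set_val x); lra.
  + exact: cvgT.
  + by apply: cvgM; [exact: cvg_cst|apply: cgap; exact: cvgT].
  + exact: cvg_cst.
- apply: continuous_corestrict => x; apply: (cvg_radial_retract (FF := nbhs_filter x)) => //.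
  + by rewrite Sr.
  + exact: cvgS.
  + exact: cvg_cst.
(* The inverse after the map: since [s <= rho], the radius that the partial push
   is sure to reach is at least the target radius. *)
- pose k (x : T) (t : R) := push (set_val x) (2 * ((1 - t) * gap (set_val x)))
    (t * mdist p (set_val x) + (1 - t) * s).
  apply: (@homotopic_into_subset _ _ _ _ _ _ k).
  + move=> x t /andP[t0 t1]; rewrite /T /k /=.
    have /andP[x0 xr] := Tr x; have := gapr _ x0; have := gap0 (set_val x).
    have := gap_rho (set_val x) => g1 g2 g3.
    have tg0 : 0 <= (1 - t) * gap (set_val x) by rewrite mulr_ge0// subr_ge0.
    have tg1 : (1 - t) * gap (set_val x) <= gap (set_val x).
      by rewrite ler_piMl//; lra.
    have tx : 0 <= t * mdist p (set_val x) by rewrite mulr_ge0// ltW.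
    have ts : 0 <= (1 - t) * s by rewrite mulr_ge0 ?subr_ge0 ?(ltW s0).
    have tgr : (1 - t) * rho <= (1 - t) * (mdist p (set_val x) + gap (set_val x)).
      by rewrite ler_wpM2l ?subr_ge0.
    have tsr : (1 - t) * s <= (1 - t) * rho by rewrite ler_wpM2l ?subr_ge0.
    rewrite push_radius ?Tr//; [|lra|lra].
    have Ix : I (mdist p (set_val x)) := set_valP x.
    case: (lerP s (mdist p (set_val x))) => sx.
      have h1 : t * s <= t * mdist p (set_val x) by rewrite ler_wpM2l.
      have h2 : (1 - t) * s <= (1 - t) * mdist p (set_val x) by rewrite ler_wpM2l// subr_ge0.
      by apply: (Iconv _ _ _ Is Ix); lra.
    have h1 : t * mdist p (set_val x) <= t * s by rewrite ler_wpM2l// ltW.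
    have h2 : (1 - t) * mdist p (set_val x) <= (1 - t) * s by rewrite ler_wpM2l ?subr_ge0// ltW.
    by apply: (Iconv _ _ _ Ix Is); lra.
  + move=> [x t] /=.
    have c1 : set_val z.1 @[z --> (x, t)] --> set_val x.
      by apply: (cvg_comp _ _ cvg_fst); exact: cvgT.
    have c2 : clamp01 z.2 @[z --> (x, t)] --> clamp01 t.
      by apply: cvg_clamp01; exact: cvg_snd.
    have c3 : 1 - clamp01 z.2 @[z --> (x, t)] --> 1 - clamp01 t.
      by apply: cvgB => //; exact: cvg_cst.
    have bd (y : T) (u : R) : 0 <= 2 * ((1 - clamp01 u) * gap (set_val y)) < 2 * r2.
      have /andP[u0 u1] := clamp01_itv u; have /andP[/gapr gy _] := Tr y.
      have gy0 := gap0 (set_val y).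
      have h1 : 0 <= (1 - clamp01 u) * gap (set_val y) by rewrite mulr_ge0// subr_ge0.
      have h2 : (1 - clamp01 u) * gap (set_val y) <= gap (set_val y) by rewrite ler_piMl//; lra.
      by lra.
    apply: cvg_push => //.
    * by move=> z; case/andP: (bd z.1 z.2).
    * by apply: cvgM; [exact: cvg_cst|apply: cvgM => //; exact: cgap].
    * apply: cvgD; apply: cvgM => //; last exact: cvg_cst.
      by apply: cvg_mdist => //; exact: cvg_cst.
  + move=> x; rewrite /k /= /corestrict /= subr0 !mul1r mul0r add0r.
    have /andP[x0 xr] := Tr x.
    have a2 : 2 * gap (set_val x) < 2 * r2 by have := gapr _ x0; lra.
    have [_ UQ _ Qr] := hQ x0 xr a2.
    have g0 := gap0 (set_val x).
    have gr := gap_rho (set_val x).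
    apply: esym; apply: radial_retract_twice; rewrite ?(ltW s0)//.
    by have := Qr (mulr_ge0 (ler0n _ 2) g0); lra.
  + move=> x; rewrite /k /= subrr !mul0r mulr0 addr0 mul1r push0 ?Tr// radial_retract_id//.
    by case/andP: (Tr x).
(* The map after the inverse: pull back to the radius [rad t], which grows from
   [s] to [rho], and push out again to radius [rho]. *)
- pose rad (t : R) := s + t * (rho - s).
  have radP t : 0 <= t <= 1 -> s <= rad t <= rho.
    move=> /andP[t0 t1]; rewrite /rad.
    have : 0 <= t * (rho - s) by rewrite mulr_ge0 ?subr_ge0.
    have : 0 <= (1 - t) * (rho - s) by rewrite mulr_ge0 ?subr_ge0.
    by lra.
  pose k (x : S) (t : R) := push (radial_retract (set_val x) (rad t)) (2 * (rho - rad t)) rho.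
  have rr (x : S) t : 0 <= t <= 1 -> mdist p (radial_retract (set_val x) (rad t)) = rad t.
    by move=> /radP h; rewrite radial_retract_radius ?US ?Sr//; lra.
  apply: (@homotopic_into_subset _ _ _ _ _ _ k).
  + move=> x t t01; have h := radP _ t01.
    by rewrite /S /metric_sphere /= /k push_radius ?rr//; lra.
  + move=> [x t] /=.
    have c1 : set_val z.1 @[z --> (x, t)] --> set_val x.
      by apply: (cvg_comp _ _ cvg_fst); exact: cvgS.
    have c2 : clamp01 z.2 @[z --> (x, t)] --> clamp01 t.
      by apply: cvg_clamp01; exact: cvg_snd.
    have c3 : rad (clamp01 z.2) @[z --> (x, t)] --> rad (clamp01 t).
      by apply: cvgD; [exact: cvg_cst|apply: cvgM => //; exact: cvg_cst].
    have rc u := radP _ (clamp01_itv u).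
    apply: cvg_push.
    * by move=> z; rewrite rr ?clamp01_itv//; have := rc z.2; lra.
    * by move=> z; have := rc z.2; lra.
    * by rewrite rr ?clamp01_itv//; have := rc t; lra.
    * by have := rc t; lra.
    * by apply: cvg_radial_retract => //; rewrite Sr.
    * by apply: cvgM; [exact: cvg_cst|apply: cvgB => //; exact: cvg_cst].
    * exact: cvg_cst.
  + move=> x; rewrite /k /= /rad mul0r addr0.
    rewrite -[RHS]/(push (radial_retract (set_val x) s)
      (2 * gap (radial_retract (set_val x) s)) rho).
    rewrite /gap radial_retract_radius ?US ?Sr ?(ltW s0)//.
    by rewrite max_r ?subr_ge0.
  + move=> x; rewrite /k /= /rad mul1r (addrC s) subrK subrr mulr0.
    have xE : radial_retract (set_val x) rho = set_val x.
      by rewrite -[in LHS](Sr x) radial_retract_id ?Sr.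
    by rewrite xE push0 ?xE// Sr rho0.
Qed.

End RadialSets.

Unset Implicit Arguments.

Theorem theorem1p5 (R : realType) (X : metricType R) (p : X) (hX : GNPC X) :
  exists2 r0 : R, 0 < r0 &
  forall r s : R, 0 < r < r0 -> 0 < s < r0 ->
    [/\ homotopy_equivalent R (set_type (metric_sphere p r))
                              (set_type (metric_sphere p s)),
        homotopy_equivalent R (set_type (metric_sphere p r))
                              (set_type (ball p s `\ p)) &
        homotopy_equivalent R (set_type (metric_sphere p r))
                              (set_type (metric_closed_ball p s `\ p))].
Proof.
have [U [geo [rb hb]]] := GNPC_normal_ball p hX.
have [r0 [Q [r00 r0rb hQ]]] := outward_push (GNPC_separable hX) hb.
exists r0 => // r s /andP[rpos rr0] /andP[spos sr0].
have main := radial_set_homotopy_equivalent hb r0rb hQ.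
have sphere t : metric_sphere p t = [set x | [set t] (mdist p x)] by [].
have single (t u : R) : 0 < t -> t <= u -> u < r0 ->
    homotopy_equivalent R (set_type (metric_sphere p t)) (set_type (metric_sphere p u)).
  move=> t0 tu ur0; rewrite (sphere t); apply: (main [set t] u t) => //.
    by move=> _ _ c -> ->; rewrite -eq_le => /eqP.
  by move=> _ ->; lra.
have [m [m0 mr ms]] : exists m, [/\ 0 < m, m <= r & m < s].
  by exists (Num.min r (s / 2)); rewrite lt_min rpos divr_gt0// ge_min lexx gt_min;
    split => //; apply/orP; right; lra.
split; apply: homotopy_equivalent_sym.
- have [rs|/ltW sr] := leP s r; first exact: single.
  by apply: homotopy_equivalent_sym; exact: single.
- rewrite (_ : _ `\ p = [set x | [set t | 0 < t < s] (mdist p x)]).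
    apply: (main _ r m) => //=; [|by move=> a /andP[]; lra|by rewrite m0].
    by move=> a b c /andP[a0 _] /andP[_ bs]; lra.
  apply/seteqP; split => x; rewrite ballEmdist /= mdist_gt0.
    by move=> [-> /eqP]; rewrite eq_sym => ->.
  by move=> /andP[px ->]; split => //; apply/eqP; rewrite eq_sym.
- rewrite (_ : _ `\ p = [set x | [set t | 0 < t <= s] (mdist p x)]).
    apply: (main _ r m) => //=; [|by move=> a /andP[]; lra|by rewrite m0 ltW].
    by move=> a b c /andP[a0 _] /andP[_ bs]; lra.
  apply/seteqP; split => x; rewrite /metric_closed_ball /= mdist_gt0.
    by move=> [-> /eqP]; rewrite eq_sym => ->.
  by move=> /andP[px ->]; split => //; apply/eqP; rewrite eq_sym.
Qed.
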